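(* Let $\mathcal{A}=\{a,b\}$ with $p=p_a\ge q=p_b$ satisfying $p+q=1$. For holes $w$ of fixed length $r\ge 2$, let $\gamma_{max}^r:=\max\{\gamma_w: w\in\mathcal{A}^r\}$. Then $$\gamma_{max}^r=\begin{cases}\gamma_{w_P}, & \text{if } p\in\left[\tfrac12,\,1-\tfrac1{r+1}\right];\\[4pt] \gamma_{w_M}, & \text{if } p\in\left[1-\tfrac1{r+1},\,1\right);\end{cases}$$ where $w_P$ denotes a word in $P^r$ and $w_M$ denotes a word in $M^r$. In addition, for $p\in\left[1-\frac1r,\,1-\frac1{r+1}\right]$ one has $\gamma_{w_P}=\log\frac1p$, and thus $\gamma_{max}^r=\log\frac1p$ in this range.
   Context: Let $\mathcal{A}=\{a,b\}$ with a probability vector $(p_a,p_b)$, $p_a,p_b>0$. Let $\mu$ be the product probability measure on $\mathcal{A}^{\mathbb{N}}$ (sequences $\omega=(\omega_0\omega_1\omega_2\dots)$) determined by this vector, and let $\sigma$ be the left shift. A word $w=(w_0w_1\dots w_{r-1})\in\mathcal{A}^r$ is identified with the hole $H=\{\omega\in\mathcal{A}^{\mathbb{N}}: \omega_i=w_i,\ 0\le i\le r-1\}$; $r$ is the length of the hole and $\mu(w)=\prod_{j=0}^{r-1}p_{w_j}$ its measure. Put $S_n=\{\omega:\sigma^i(\omega)\notin H,\ i=0,\dots,n\}$ and $p_n=\mu(S_n)$. The escape rate of $w$ is $\gamma_w:=\liminf_{n\to\infty}\frac{-\log p_n}{n}$. The hole $w\in\mathcal{A}^r$ is prime if for no $i\in\{1,\dots,r-1\}$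 one has $(w_iw_{i+1}\dots w_{r-1})=(w_0w_1\dots w_{r-1-i})$. Define $P^r:=\{w\in\mathcal{A}^r: w \text{ is prime and } \mu(w)\ge\mu(\tilde w) \text{ for all prime } \tilde w\in\mathcal{A}^r\}$ and $M^r:=\{w\in\mathcal{A}^r:\mu(w)\ge\mu(\tilde w)\text{ for all }\tilde w\in\mathcal{A}^r\}$. *)

(* Defs.v *)
From HB Require Import structures.
From mathcomp Require Import all_boot all_order all_algebra.
From mathcomp Require Import all_classical all_reals all_analysis.

Set Implicit Arguments.
Unset Strict Implicit.
Unset Printing Implicit Defensive.

Import Order.TTheory GRing.Theory Num.Theory.

Local Open Scope classical_set_scope.
Local Open Scope ring_scope.

(* The alphabet {a, b}, with a := true and b := false. *)
Notation letter := bool.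

Definition hole (r : nat) (w : r.-tuple letter) : set (nat -> letter) :=
  [set omega | forall i : 'I_r, omega i = tnth w i].

Definition cylinders : set (set (nat -> letter)) :=
  [set C | exists (r : nat) (w : r.-tuple letter), C = hole w].

(* As a type this is nat -> letter; its sigma-algebra is <<s cylinders >>, the
   product sigma-algebra. *)
Notation sequences := (g_sigma_algebraType cylinders).

Definition letter_prob (R : realType) (p q : R) (x : letter) : R :=
  if x then p else q.

Definition word_prob (R : realType) (p q : R) (r : nat) (w : r.-tuple letter) : R :=
  \prod_(j < r) letter_prob p q (tnth w j).

(* The cylinders, together with the empty set, form a pi-system generating the
   sigma-algebra, so this determines mu. *)
Definition is_product_measure (R : realType) (p q : R)
    (mu : probability sequences R) : Prop :=
  forall (r : nat) (w : r.-tuple letter), mu (hole w) = (word_prob p q w)%:E.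

Definition left_shift (omega : nat -> letter) : nat -> letter :=
  fun i => omega i.+1.

Definition survivors (r : nat) (w : r.-tuple letter) (n : nat) :
    set (nat -> letter) :=
  [set omega | forall i : nat, (i <= n)%N -> ~ hole w (iter i left_shift omega)].

(* The term of index n = 0 is 0, since 0^-1 = 0; it does not affect the limit
   inferior. *)
Definition escape_rate (R : realType) (mu : probability sequences R)
    (r : nat) (w : r.-tuple letter) : \bar R :=
  limn_einf (fun n : nat => (- lne (mu (survivors w n)) * (n%:R^-1)%:E)%E).

Definition max_escape_rate (R : realType) (mu : probability sequences R)
    (r : nat) : \bar R :=
  \big[maxe/-oo%E]_(w : r.-tuple letter) escape_rate mu w.

Definition prime_hole (r : nat) (w : r.-tuple letter) : Prop :=
  ~ exists i : nat, (1 <= i <= r - 1)%N /\ drop i w = take (r - i) w.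

Definition max_prime_words (R : realType) (p q : R) (r : nat) :
    set (r.-tuple letter) :=
  [set w | prime_hole w /\
    forall w' : r.-tuple letter, prime_hole w' -> word_prob p q w' <= word_prob p q w].

Definition max_words (R : realType) (p q : R) (r : nat) : set (r.-tuple letter) :=
  [set w | forall w' : r.-tuple letter, word_prob p q w' <= word_prob p q w].

Arguments max_prime_words {R} p q r.
Arguments max_words {R} p q r.

(* Main.v *)
Require Import Defs.
From mathcomp Require Import all_boot all_order all_algebra.
From mathcomp Require Import ring lra zify.
From mathcomp Require Import all_classical all_reals all_analysis.

(* Write A_w(n) for the probability that a random word of length n does not
   contain w, so that mu(S_n) = A_w(n + r). Cutting at the first letter shows
   A_w(n + 1) >= A_w(n) - mu(w) A_w(n + 1 - r), with equality when w is prime.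
   A word containing b has measure at most p ^ (r - 1) q, attained by the
   maximal prime words w_P; comparing ratios in these recursions shows that w_P
   survives least among the words containing b. It remains to place w_M = a ^ r,
   for which A(n) = q sum_(i < r) p ^ i A(n - i - 1): relative to p ^ n, the sum
   of these weights is r q / p, so A(n) is at most or at least a constant times
   p ^ n according to whether r q <= p or r q >= p. For w_P, the increments
   A(n + 1) - p A(n) obey the same recursion with r - 1 in place of r, so
   A_{w_P}(n) is at most (n + 1) A_{w_M}(n) up to a constant when r q >= p, and
   at most (n + 1) p ^ n up to a constant when (r - 1) q <= p; it is always at
   least p ^ n. *)

Set Implicit Arguments.
Unset Strict Implicit.
Unset Printing Implicit Defensive.

Import Order.TTheory GRing.Theory Num.Theory.

Local Open Scope classical_set_scope.
Local Open Scope ring_scope.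

(** * Words avoiding a factor *)

(** This is the probability that [n] independent letters spell a word satisfying [P]. Recursion on
    the first letter keeps the combinatorics free of measure theory; [product_measure_mkseq_prefix]
    makes the link with [mu]. *)
Fixpoint bernoulli_mass (R : realType) (p q : R) (n : nat)
    (P : pred (seq letter)) : R :=
  if n is m.+1 then
    p * bernoulli_mass p q m (fun s => P (true :: s)) +
    q * bernoulli_mass p q m (fun s => P (false :: s))
  else (P [::])%:R.

Definition avoidance (R : realType) (p q : R) (w : seq letter) (n : nat) : R :=
  bernoulli_mass p q n (fun s => ~~ infix w s).

Definition seq_prob (R : realType) (p q : R) (w : seq letter) : R :=
  \prod_(x <- w) letter_prob p q x.

Section Words.
Context (R : realType) (p q : R).
Hypotheses (p_gt0 : 0 < p) (q_gt0 : 0 < q) (pq1 : p + q = 1).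

Local Notation mass := (bernoulli_mass p q).
Local Notation avoid := (avoidance p q).
Local Notation prob := (seq_prob p q).

Let p_ge0 : 0 <= p := ltW p_gt0.
Let q_ge0 : 0 <= q := ltW q_gt0.

Lemma mass_ext n (P Q : pred (seq letter)) :
  (forall s, size s = n -> P s = Q s) -> mass n P = mass n Q.
Proof.
elim: n P Q => [|n IH] P Q PQ /=; first by rewrite PQ.
by congr (_ * _ + _ * _); apply: IH => s sn; apply: PQ; rewrite /= sn.
Qed.

Lemma mass_ge0 n P : 0 <= mass n P.
Proof. by elim: n P => [|n IH] P /=; rewrite ?ler0n// addr_ge0// mulr_ge0. Qed.

Lemma mass_le n (P Q : pred (seq letter)) :
  (forall s, size s = n -> P s -> Q s) -> mass n P <= mass n Q.
Proof.
elim: n P Q => [|n IH] P Q PQ /=.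
  by have := PQ [::] erefl; case: (P _) => [->|].
by apply: lerD; apply: ler_wpM2l => //; apply: IH => s sn; apply: PQ; rewrite /= sn.
Qed.

Lemma mass_predT n : mass n predT = 1.
Proof.
elim: n => //= n IH; rewrite -pq1 -[in RHS](mulr1 p) -[in RHS](mulr1 q).
by congr (_ * _ + _ * _); exact: IH.
Qed.

Lemma mass_pred0 n : mass n pred0 = 0.
Proof.
elim: n => //= n IH; transitivity (p * 0 + q * 0); last by rewrite !mulr0 addr0.
by congr (_ * _ + _ * _); exact: IH.
Qed.

Lemma mass_split n P Q :
  mass n P = mass n (predI P Q) + mass n (predI P (predC Q)).
Proof.
elim: n P Q => [|n IH] P Q /=.
  by case: (P _); case: (Q _); rewrite /= ?addr0 ?add0r.
rewrite (IH (fun s => P (true :: s)) (fun s => Q (true :: s))).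
rewrite (IH (fun s => P (false :: s)) (fun s => Q (false :: s))) /=.
rewrite /predI /predC /=; ring.
Qed.

Lemma mass_behead n P : mass n.+1 (fun s => P (behead s)) = mass n P.
Proof. by rewrite /= -mulrDl pq1 mul1r. Qed.

Lemma mass_prefix (w : seq letter) n (P : pred (seq letter)) :
  mass (size w + n) (fun s => prefix w s && P (drop (size w) s)) = prob w * mass n P.
Proof.
elim: w => [|x w IH]; rewrite /seq_prob ?big_nil ?big_cons.
  by rewrite mul1r; apply: mass_ext => s; rewrite drop0 prefix0s.
rewrite addSn /=.
have E y : mass (size w + n) (fun s => (x == y) && prefix w s && P (drop (size w) s))
   = (x == y)%:R * (prob w * mass n P).
  rewrite -IH; case: (x == y); rewrite ?mul1r ?mul0r; last exact: mass_pred0.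
  exact: mass_ext.
rewrite !E /letter_prob; case: x {E}; rewrite /= /seq_prob; ring.
Qed.

Lemma mass_ge_constant (x : letter) n (P : pred (seq letter)) :
  P (nseq n x) -> letter_prob p q x ^+ n <= mass n P.
Proof.
elim: n P => [|n IH] P Pn /=; first by rewrite Pn.
rewrite exprS /letter_prob; case: x IH Pn => IH Pn.
  by rewrite -[leLHS]addr0 lerD ?mulr_ge0 ?mass_ge0// ler_wpM2l// IH.
by rewrite -[leLHS]add0r lerD ?mulr_ge0 ?mass_ge0// ler_wpM2l// IH.
Qed.

Lemma avoid_ge0 w n : 0 <= avoid w n.
Proof. exact: mass_ge0. Qed.

Lemma avoid_short w n : (n < size w)%N -> avoid w n = 1.
Proof.
move=> nw; rewrite -(mass_predT n); apply: mass_ext => s sn.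
by apply/negP => /size_infix; rewrite sn leqNgt nw.
Qed.

Lemma avoid_ge_constant (x : letter) w n :
  (~~ x) \in w -> letter_prob p q x ^+ n <= avoid w n.
Proof.
move=> xw; apply: mass_ge_constant; apply/negP => /mem_infix /(_ _ xw).
by rewrite mem_nseq => /andP[_]; case: x {xw}.
Qed.


(** A word whose tail avoids [w] can contain [w] only as a prefix. *)
Lemma avoidS w n : (0 < size w)%N ->
  avoid w n.+1 = avoid w n -
    mass n.+1 (fun s => prefix w s && ~~ infix w (behead s)).
Proof.
move=> w_gt0; rewrite /avoidance -(mass_behead n (fun s => ~~ infix w s)).
rewrite [X in _ = X - _](mass_split _ _ (fun s => prefix w s)).
rewrite [X in _ = X + _ - _](_ : _ =
  mass n.+1 (fun s => prefix w s && ~~ infix w (behead s))); last first.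
  by apply: mass_ext => s _ /=; rewrite andbC.
rewrite [X in X - _]addrC addrK; apply: mass_ext => -[//|x s] _ /=.
by rewrite negb_or andbC.
Qed.

(** If a word starts with [w] and its tail avoids [w], then what follows the prefix avoids [w] too,
    and by [mass_prefix] that remainder is independent of the prefix. *)
Lemma avoid_recursion_ge w n : (0 < size w)%N -> (size w <= n.+1)%N ->
  avoid w n - prob w * avoid w (n.+1 - size w) <= avoid w n.+1.
Proof.
move=> w_gt0 wn; rewrite (avoidS _ w_gt0) lerD2l lerN2 -mass_prefix subnKC//.
apply: mass_le => s _ /andP[-> /=]; apply: contra => ws; move: w_gt0 ws.
case: w {wn} => [//|y w] _; case: s => [//|x s] /= ws.
rewrite -(cat_take_drop (size w) s); exact: infix_catl.
Qed.

(** For prime [w] the inclusion used in [avoid_recursion_ge] is an equality: an occurrence in the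
    tail cannot overlap the prefix [w], so it already lies in the remainder. *)
Lemma avoid_recursion_prime w n : (0 < size w)%N -> (size w <= n.+1)%N ->
  (forall i, (0 < i < size w)%N -> drop i w <> take (size w - i) w) ->
  avoid w n.+1 = avoid w n - prob w * avoid w (n.+1 - size w).
Proof.
move=> w_gt0 wn w_prime; apply/eqP; rewrite eq_le avoid_recursion_ge// andbT.
rewrite (avoidS _ w_gt0) lerD2l lerN2 -mass_prefix subnKC//.
apply: mass_le => s _ /andP[/prefixP[t ->]]; rewrite prefix_prefix /=.
rewrite drop_size_cat//; apply: contra.
case: w w_gt0 {wn} w_prime => // x w _ w_prime /=.
move=> /infixP[u [v uv]].
(* Here [w] is the hole without its first letter [x], and [u] precedes the occurrence in the tail
   [w ++ t]. If [u] is at least as long as [w], the occurrence lies in [t]. *)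
have [wu|uw] := leqP (size w) (size u).
  apply/infixP; exists (drop (size w) u), v.
  have := congr1 (drop (size w)) uv.
  rewrite (drop_size_cat t (erefl (size w))) => ->.
  rewrite drop_cat; case: ltnP => //; rewrite leq_eqVlt ltnNge wu orbF => /eqP <-.
  by rewrite subnn drop0 drop_size.
(* Otherwise the occurrence starts inside the first copy of the hole, at position [size u + 1] once
   [x] is counted, and the overlap identifies a suffix with a prefix. *)
exfalso; apply: (w_prime (size u).+1) => //=.
have := congr1 (drop (size u)) uv.
rewrite (drop_cat (size u) w t) uw (drop_size_cat _ (erefl (size u))).
move=> /(congr1 (take (size w - size u))).
rewrite (take_size_cat t (size_drop (size u) w)).
rewrite subSS => ->; rewrite takel_cat//=.
by rewrite ltnW// ltnS leq_subr.
Qed.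

(** The [false] ends the leading run before it reaches length [r], so an occurrence must lie
    entirely beyond it. *)
Lemma infix_nseq_cat r k (s : seq letter) : (k < r)%N ->
  infix (nseq r true) (nseq k true ++ false :: s) = infix (nseq r true) s.
Proof.
elim: k => [|k IH] kr.
  by case: r kr => //.
rewrite cat_cons infix_consl IH ?(ltnW kr)//.
suff -> : prefix (nseq r true) (true :: nseq k true ++ false :: s) = false by [].
apply/negP => /prefixP[t] /(congr1 (fun l => nth true l k.+1)) /=.
by rewrite !nth_cat !size_nseq ltnn subnn /= kr nth_nseq kr.
Qed.

(** Words are sorted by their number [i] of leading [a]. For [i < j] the next letter is [b] and the
    remaining [n - i - 1] letters need only avoid [a ^ r]; the first term collects the words with at
    least [j] leading [a], and vanishes for [j = r]. *)
Lemma avoid_runs r n j : (j <= r)%N -> (j <= n)%N ->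
  avoid (nseq r true) n =
    p ^+ j * mass (n - j) (fun s => ~~ infix (nseq r true) (nseq j true ++ s))
    + q * \sum_(i < j) p ^+ i * avoid (nseq r true) (n - i.+1).
Proof.
elim: j => [|j IH] jr jn.
  by rewrite big_ord0 mulr0 addr0 expr0 mul1r subn0.
rewrite IH ?(ltnW jr) ?(ltnW jn)// -(subnSK jn) /= big_ord_recr /=.
rewrite [X in _ = _ * X + _](_ : _ =
   mass (n - j.+1) (fun s => ~~ infix (nseq r true) (nseq j true ++ true :: s))).
  rewrite [X in p * _ + q * X](_ : _ = avoid (nseq r true) (n - j.+1)).
    by rewrite exprSr; ring.
  by apply: mass_ext => s _; rewrite infix_nseq_cat.
apply: mass_ext => s _.
rewrite (_ : nseq j true ++ true :: s = nseq j.+1 true ++ s)//.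
by rewrite -addn1 nseqD -catA.
Qed.

Lemma avoid_runs_recursion r n : (r <= n)%N ->
  avoid (nseq r true) n =
    q * \sum_(i < r) p ^+ i * avoid (nseq r true) (n - i.+1).
Proof.
move=> rn; rewrite {1}(avoid_runs (leqnn r) rn).
rewrite (mass_ext (Q := pred0)) ?mass_pred0 ?mulr0 ?add0r//.
by move=> s _; rewrite prefix_infix.
Qed.

Lemma seq_prob_ge0 w : 0 <= prob w.
Proof. by apply: prodr_ge0 => -[]. Qed.

Lemma seq_prob_rcons w x : prob (rcons w x) = prob w * letter_prob p q x.
Proof. by rewrite /seq_prob -cats1 big_cat big_seq1. Qed.

Lemma seq_prob_nseq_true n : prob (nseq n true) = p ^+ n.
Proof. by rewrite /seq_prob big_nseq /= iter_mulr_1. Qed.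

Lemma seq_prob_le_power w : q <= p -> prob w <= p ^+ size w.
Proof.
move=> qp; elim: w => [|x w IH]; first by rewrite /seq_prob big_nil.
rewrite /seq_prob big_cons exprS ler_pM ?seq_prob_ge0//; by case: x.
Qed.

Lemma seq_prob_le_one_false w : q <= p -> false \in w ->
  prob w <= p ^+ (size w).-1 * q.
Proof.
move=> qp; elim: w => // x w IH; rewrite in_cons /seq_prob big_cons -/(prob w) /=.
case: x => /=; last by rewrite mulrC ler_wpM2r// seq_prob_le_power.
move=> wF; apply: (le_trans (ler_wpM2l p_ge0 (IH wF))).
by rewrite mulrA -exprS prednK//; case: (w) wF.
Qed.

End Words.

(** * Prime words and words of maximal measure *)

Lemma notin_false_nseq (w : seq letter) : false \notin w -> w = nseq (size w) true.
Proof.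
by move=> wF; apply/all_pred1P/allP => -[] //= /(negP wF).
Qed.

Lemma tuple_seq_prob (R : realType) (p q : R) r (w : r.-tuple letter) :
  word_prob p q w = seq_prob p q w.
Proof. by rewrite /word_prob /seq_prob big_tuple. Qed.

Lemma prime_holeP r (w : r.-tuple letter) :
  prime_hole w <-> forall i, (0 < i < r)%N -> drop i w <> take (r - i) w.
Proof.
split=> [w_prime i ir wi|w_prime [i [ir wi]]].
  by apply: w_prime; exists i; split => //; lia.
by apply: (w_prime i) wi; lia.
Qed.

(** The word [a ^ r] agrees with itself after a shift by one, a shift that primality forbids since
    [r >= 2]. *)
Lemma prime_hole_has_false r (w : r.-tuple letter) :
  (2 <= r)%N -> prime_hole w -> false \in (w : seq letter).
Proof.
move=> r2 /prime_holeP /(_ 1%N); rewrite r2 => /(_ isT) w_prime.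
apply: contrapT => /negP /notin_false_nseq wE; apply: w_prime.
by rewrite wE size_tuple drop_nseq take_nseq; last lia.
Qed.

Lemma prime_hole_prob_le (R : realType) (p q : R) r (w : r.-tuple letter) :
  0 < p -> 0 < q -> q <= p -> (2 <= r)%N -> prime_hole w ->
  seq_prob p q w <= p ^+ r.-1 * q.
Proof.
move=> p0 q0 qp r2 w_prime.
have := seq_prob_le_one_false p0 q0 qp (prime_hole_has_false r2 w_prime).
by rewrite size_tuple.
Qed.

Lemma exists_prime_hole_prob (R : realType) (p q : R) r : (0 < r)%N ->
  exists2 w : r.-tuple letter, prime_hole w & seq_prob p q w = p ^+ r.-1 * q.
Proof.
(* The witness is [a ^ (r - 1) b]: its nonempty suffixes contain [b], its proper prefixes do not. *)
move=> r_gt0; have rE : size (rcons (nseq r.-1 true) false) == r.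
  by rewrite size_rcons size_nseq prednK.
exists (Tuple rE); last by rewrite /= seq_prob_rcons// seq_prob_nseq_true.
apply/prime_holeP => i /andP[i_gt0 ir] /= dt.
have : false \in drop i (rcons (nseq r.-1 true) false).
  rewrite -cats1 drop_cat size_nseq; case: ltnP => ir1.
    by rewrite mem_cat mem_seq1 eqxx orbT.
  by have -> : (i - r.-1 = 0)%N by lia.
rewrite dt -cats1 takel_cat ?size_nseq; last by lia.
by move/mem_take; rewrite mem_nseq andbF.
Qed.

Lemma max_prime_wordsP (R : realType) (p q : R) r (w : r.-tuple letter) :
  0 < p -> 0 < q -> q <= p -> (2 <= r)%N ->
  max_prime_words p q r w <->
  prime_hole w /\ seq_prob p q w = p ^+ r.-1 * q.
Proof.
move=> p0 q0 qp r2; split=> -[w_prime w_max]; split=> //.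
  apply/eqP; rewrite eq_le prime_hole_prob_le//=.
  have [u u_prime <-] := exists_prime_hole_prob p q (ltnW r2).
  by have := w_max _ u_prime; rewrite !tuple_seq_prob.
by move=> u u_prime; rewrite !tuple_seq_prob w_max prime_hole_prob_le.
Qed.

Lemma max_words_nseq_true (R : realType) (p q : R) r (w : r.-tuple letter) :
  0 < q -> q < p -> max_words p q r w -> w = nseq r true :> seq letter.
Proof.
move=> q0 qp w_max; have p0 := lt_trans q0 qp.
rewrite -[in RHS](size_tuple w); apply: notin_false_nseq; apply/negP => wF.
have := w_max (nseq_tuple r true); rewrite !tuple_seq_prob seq_prob_nseq_true.
apply/negP; rewrite -ltNge.
apply: le_lt_trans (seq_prob_le_one_false p0 q0 (ltW qp) wF) _.
rewrite size_tuple; case: r w wF {w_max} => [|r] w wF; first by rewrite tuple0 in wF.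
by rewrite exprSr ltr_pM2l ?exprn_gt0.
Qed.

(** * Linear recursions *)

(* The induction compares the ratios [a n / a k] and [b n / b k]: a lower ratio
   makes the delayed term relatively larger, hence the next ratio lower. *)
Lemma delay_recursion_comparison (R : realType) (a b : nat -> R) (c : R) (r : nat) :
  (0 < r)%N -> 0 <= c -> (forall n, 0 < a n) -> (forall n, 0 < b n) ->
  (forall n, (n < r)%N -> a n = b n) ->
  (forall n, (r <= n.+1)%N -> a n - c * a (n.+1 - r)%N <= a n.+1) ->
  (forall n, (r <= n.+1)%N -> b n.+1 = b n - c * b (n.+1 - r)%N) ->
  forall n, b n <= a n.
Proof.
move=> r_gt0 c_ge0 a_gt0 b_gt0 ab0 recA recB.
suff ratio n k : (k <= n)%N -> b n * a k <= a n * b k.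
  by move=> n; have := ratio _ _ (leq0n n); rewrite (ab0 0%N)// ler_pM2r.
elim: n k => [|n IH] k; first by rewrite leqn0 => /eqP ->; rewrite mulrC.
rewrite leq_eqVlt ltnS => /predU1P[->|kn]; first by rewrite mulrC.
have step : b n.+1 * a n <= a n.+1 * b n.
  have [nr|rn] := ltnP n.+1 r; first by rewrite !ab0 ?(ltnW nr)// mulrC.
  apply: (@le_trans _ _ ((a n - c * a (n.+1 - r)%N) * b n)); last first.
    by rewrite ler_pM2r// recA.
  rewrite recB// !mulrBl [b n * _]mulrC lerD2l lerN2 -!mulrA ler_wpM2l//.
  rewrite mulrC [leRHS]mulrC; apply: IH.
  by rewrite leq_subLR -addn1 addnC leq_add2r.
(* The claim for [n + 1] and [k] is the product of [step] and the claim for [n] and [k], with the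
   factor [a n * b n] cancelled. *)
rewrite -(ler_pM2r (b_gt0 n)) -(ler_pM2r (a_gt0 n)).
have := ler_pM (mulr_ge0 _ _) (mulr_ge0 _ _) step (IH _ kn).
move=> /(_ (ltW (b_gt0 _)) (ltW (a_gt0 _)) (ltW (b_gt0 _)) (ltW (a_gt0 _))).
congr (_ <= _); ring.
Qed.

Section Recursions.
Context (R : realType) (p q : R).
Hypotheses (p_gt0 : 0 < p) (q_gt0 : 0 < q) (pq1 : p + q = 1).

Let p_ge0 : 0 <= p := ltW p_gt0.
Let q_ge0 : 0 <= q := ltW q_gt0.
Let p_le1 : p <= 1. Proof. by rewrite -pq1 lerDl ltW. Qed.
Let q_le1 : q <= 1. Proof. by rewrite -pq1 lerDr ltW. Qed.

(** The number [s] of terms and the first valid index [k] are kept apart: the avoidance of [a ^ r]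
    has [k = s = r], while the increments attached to a prime word have [k = s + 1]. *)
Definition run_recursion (k s : nat) (x : nat -> R) :=
  forall n, (k <= n)%N -> x n = q * \sum_(i < s) p ^+ i * x (n - i.+1)%N.

(** Inserting [p ^ n] into the right-hand side gives [s q p ^ (n - 1)], at most [p ^ n], so upper
    bounds by multiples of [p ^ n] propagate. The factor [p ^ k] absorbs the initial values. *)
Lemma run_recursion_upper k s (x : nat -> R) :
  (s <= k)%N -> (forall n, (n < k)%N -> x n <= 1) -> run_recursion k s x ->
  s%:R * q <= p -> forall n, p ^+ k * x n <= p ^+ n.
Proof.
move=> sk x_le1 rec sq n; elim/ltn_ind: n => n IH.
have [nk|kn] := ltnP n k.
  apply: (@le_trans _ _ (p ^+ k)).
    by rewrite -[leRHS]mulr1 ler_pM2l ?exprn_gt0// x_le1.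
  by rewrite ler_wiXn2l ?p_ge0// ltnW.
case: n IH kn => [|n] IH kn.
  move: kn; rewrite leqn0 => /eqP k0; move: sk; rewrite k0 leqn0 => /eqP s0.
  by rewrite rec ?k0// s0 big_ord0 !mulr0.
rewrite rec// mulrCA mulr_sumr.
apply: (@le_trans _ _ (q * \sum_(i < s) p ^+ n)).
  rewrite ler_pM2l//; apply: ler_sum => i _; rewrite mulrCA.
  have iN : (i <= n)%N by have := ltn_ord i; lia.
  rewrite -[in leRHS](subnKC iN) exprD ler_pM2l ?exprn_gt0// subSS IH//; lia.
rewrite sumr_const card_ord -mulr_natl exprS mulrA ler_pM2r ?exprn_gt0//.
by rewrite mulrC.
Qed.

(** When [r q >= p], lower bounds by multiples of [p ^ n] propagate. The base index [j] is arbitrary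
    because the bound is later applied to every term of a convolution. *)
Lemma run_recursion_lower r (x : nat -> R) :
  (0 < r)%N -> (forall n, 0 <= x n) -> (forall n, (n < r)%N -> x n = 1) ->
  run_recursion r r x -> p <= r%:R * q ->
  forall j n, (j <= n)%N -> q ^+ r * (p ^+ (n - j) * x j) <= x n.
Proof.
move=> r_gt0 x_ge0 x1 rec rq.
have xS n : q * x n <= x n.+1.
  have [nr|rn] := ltnP n.+1 r; first by rewrite !x1 ?mulr1// ltnW.
  rewrite [leRHS]rec// ler_pM2l//; case: r r_gt0 {x1 rec rq} rn => // r _ rn.
  rewrite big_ord_recl expr0 mul1r subn1 lerDl.
  by apply: sumr_ge0 => i _; rewrite mulr_ge0 ?exprn_ge0.
move=> j n; elim/ltn_ind: n => n IH jn.
(* In the window of [r] indices starting at [j], the one-step bound [xS] loses at most [q ^ r];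
   beyond it, all [r] delayed indices are at least [j] and induction applies. *)
have [njr|rnj] := ltnP (n - j)%N r.
  apply: (@le_trans _ _ (q ^+ (n - j) * x j)).
    rewrite mulrA ler_wpM2r// -[leRHS]mulr1 ler_pM ?exprn_ge0//.
      by rewrite ler_wiXn2l// ltnW.
    by rewrite exprn_ile1.
  rewrite -{2}(subnKC jn); elim: (n - j)%N => [|k IHk]; first by rewrite mul1r addn0.
  by rewrite exprS -mulrA addnS (le_trans _ (xS _))// ler_pM2l.
rewrite [leRHS]rec; last by lia.
have := leq_trans r_gt0 rnj; case nj : (n - j)%N => [//|m] _.
apply: (@le_trans _ _ (q * \sum_(i < r) q ^+ r * (p ^+ m * x j))).
  rewrite sumr_const card_ord -mulr_natl exprS -mulrA mulrCA [leRHS]mulrA.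
  by rewrite ler_wpM2r ?mulr_ge0 ?exprn_ge0// mulrC.
rewrite ler_pM2l//; apply: ler_sum => i _.
have iN := ltn_ord i.
have -> : m = (i + (n - i.+1 - j))%N by lia.
rewrite exprD -mulrA mulrCA ler_pM2l ?exprn_gt0// IH//; lia.
Qed.

(** * The recursion of a maximal prime word of length [s + 1] *)

Section PrimeRecursion.
Context (s : nat) (b : nat -> R).
Hypothesis b1 : forall n, (n <= s)%N -> b n = 1.
Hypothesis recB : forall n, (s <= n)%N -> b n.+1 = b n - p ^+ s * q * b (n - s)%N.

(* [1 - z + p ^ s q z ^ (s + 1)], the denominator of the generating function
   of [b], is divisible by [1 - p z]: the quotient governs [v]. *)
Let v n := if n is m.+1 then b m.+1 - p * b m else 1.

(** Solving [b (n + 1) = p * b n + v (n + 1)] expresses [b] as the convolution of [v] with the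
    powers of [p]. *)
Let b_sum n : b n = \sum_(j < n.+1) p ^+ (n - j) * v j.
Proof.
elim: n => [|n IH]; first by rewrite big_ord_recl big_ord0 addr0 mulr1 b1.
rewrite big_ord_recr subnn mul1r /= [X in X + _](_ : _ = p * b n).
  by rewrite addrC subrK.
rewrite IH mulr_sumr; apply: eq_bigr => i _.
by rewrite mulrA -exprS subSn// -ltnS.
Qed.

(** The sum telescopes to [b n - p ^ s * b (n - s)], and multiplying by [q = 1 - p] recovers
    [b (n + 1) - p * b n]. *)
Let v_rec : run_recursion s.+1 s v.
Proof.
case=> // n sn; rewrite /= recB//.
have tele k : (k <= n)%N ->
    \sum_(i < k) p ^+ i * v (n.+1 - i.+1)%N = b n - p ^+ k * b (n - k)%N.
  elim: k => [|k IH] kn; first by rewrite big_ord0 subn0 mul1r subrr.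
  rewrite big_ord_recr IH ?(ltnW kn)//= subSS -(subnSK kn) /= exprSr; ring.
have -> : q = 1 - p by rewrite -pq1 addrC addKr.
rewrite tele//; ring.
Qed.

Let v_small n : (n < s.+1)%N -> v n <= 1.
Proof.
case: n => [//|n] ns /=; have ns' : (n <= s)%N by rewrite -ltnS ltnW.
by rewrite !b1// mulr1 lerBlDr lerDl.
Qed.

(** By [run_recursion_upper], each of the [n + 1] terms of the convolution is at most [p ^ n] up to
    the constant [p ^ (s + 1)]. *)
Lemma prime_recursion_le_power :
  s%:R * q <= p -> forall n, p ^+ s.+1 * b n <= n.+1%:R * p ^+ n.
Proof.
move=> sq n; have v_le := run_recursion_upper (leqnSn s) v_small v_rec sq.
rewrite b_sum mulr_sumr mulr_natl -[in leRHS](card_ord n.+1) -sumr_const.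
apply: ler_sum => j _; rewrite mulrCA -[in leRHS](subnK (_ : j <= n)%N) -1?ltnS//.
by rewrite exprD ler_pM2l ?exprn_gt0.
Qed.

(** The recursion of [m] has one more nonnegative term than that of [v], so [v <= m]; then
    [run_recursion_lower] bounds each term [p ^ (n - j) * m j] of the convolution by [m n] up to a
    constant. *)
Lemma prime_recursion_le_run (m : nat -> R) :
  (forall n, 0 <= m n) -> (forall n, (n < s.+1)%N -> m n = 1) ->
  run_recursion s.+1 s.+1 m -> p <= s.+1%:R * q ->
  forall n, q ^+ s.+1 * b n <= n.+1%:R * m n.
Proof.
move=> m_ge0 m1 recM sq n.
have v_le k : v k <= m k.
  elim/ltn_ind: k => k IH; have [ks|sk] := ltnP k s.+1.
    by rewrite m1// v_small.
  rewrite v_rec// recM// ler_pM2l// [leRHS]big_ord_recr /= -[leLHS]addr0 lerD//.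
    apply: ler_sum => i _; rewrite ler_pM2l ?exprn_gt0// IH//.
    by have := ltn_ord i; lia.
  by rewrite mulr_ge0// exprn_ge0.
rewrite b_sum mulr_sumr mulr_natl -[in leRHS](card_ord n.+1) -sumr_const.
apply: ler_sum => j _.
apply: le_trans
  (run_recursion_lower _ m_ge0 m1 recM sq (_ : j <= n)%N) => //; last first.
  by rewrite -ltnS.
by rewrite ler_pM2l ?exprn_gt0// ler_pM2l ?exprn_gt0.
Qed.

End PrimeRecursion.
End Recursions.

(** * Exponential decay rates *)

Lemma limn_einf_le_near (R : realType) (u v : nat -> \bar R) (N : nat) :
  (forall n, (N <= n)%N -> (u n <= v n)%E) -> (limn_einf u <= limn_einf v)%E.
Proof.
move=> uv; rewrite !limn_einf_lim; apply: lee_lim; [exact: is_cvg_einfs..|].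
exists N => // n /= Nn; apply: le_ereal_inf_tmp => _ /= [k nk <-].
apply: ge_ereal_inf; exists (u k); first by exists k.
by rewrite uv// (leq_trans Nn).
Qed.

Lemma linear_le_expR (R : realType) (C e : R) : 0 <= C -> 0 < e ->
  exists N, forall n, (N <= n)%N -> C * n.+1%:R <= expR (e * n%:R).
Proof.
(* From [8 C <= e ^ 2 n] and [n >= 1] one gets [C (n + 1) <= 2 C n <= (e n / 2) ^ 2], which is at
   most the square of [expR (e n / 2)]. *)
move=> C0 e0; exists (Num.bound (8 * C / e ^+ 2)).+1 => n Nn.
have n1 : 1 <= n%:R :> R by rewrite ler1n; lia.
have nC : 8 * C / e ^+ 2 <= n%:R.
  apply: (le_trans (ltW (archi_boundP _))); last by rewrite ler_nat; lia.
  by rewrite divr_ge0 ?mulr_ge0 ?exprn_ge0// ltW.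
rewrite ler_pdivrMr ?exprn_gt0// in nC.
have -> : e * n%:R = (e * n%:R / 2) + (e * n%:R / 2) by field.
rewrite expRD -natr1.
have en : 0 <= e * n%:R / 2 by rewrite divr_ge0 ?mulr_ge0// ltW.
have h := expR_ge1Dx (e * n%:R / 2).
have h1 : (e * n%:R / 2) * (e * n%:R / 2) <=
    expR (e * n%:R / 2) * expR (e * n%:R / 2).
  by apply: ler_pM => //; lra.
apply: le_trans h1; nra.
Qed.

Definition decay_rate (R : realType) (x : nat -> R) : \bar R :=
  limn_einf (fun n => (- ln (x n) * n%:R^-1)%:E).

Lemma decay_rate_le (R : realType) (C : R) (x y : nat -> R) :
  (forall n, 0 < x n) -> (forall n, 0 < y n) ->
  (forall n, y n <= C * n.+1%:R * x n) -> (decay_rate x <= decay_rate y)%E.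
Proof.
move=> x0 y0 yx; have C0 : 0 <= C.
  have := lt_le_trans (y0 0%N) (yx 0%N).
  by rewrite mulr1 pmulr_lgt0// => /ltW.
(* The linear factor is eventually below [expR (e * n)], which costs only [e] in the rate. *)
apply/lee_addgt0Pr => e e0; rewrite addeC /decay_rate -limn_einf_shift//.
have [N CN] := linear_le_expR C0 e0.
apply: (@limn_einf_le_near _ _ _ N.+1) => n Nn.
have n0 : 0 < n%:R :> R by rewrite ltr0n; lia.
rewrite -EFinD lee_fin -(ler_pM2r n0) mulrDl !divfK ?gt_eqF//.
have : y n <= expR (e * n%:R) * x n.
  by apply: (le_trans (yx n)); rewrite ler_pM2r// CN// ltnW.
rewrite -ler_ln ?posrE ?mulr_gt0 ?expR_gt0// lnM ?posrE ?expR_gt0// expRK; lra.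
Qed.

Lemma decay_rate_expr (R : realType) (p : R) : 0 < p ->
  decay_rate (fun n => p ^+ n) = (ln (1 / p))%:E.
Proof.
move=> p0; have E n : (0 < n)%N -> - ln (p ^+ n) * n%:R^-1 = ln (1 / p).
  move=> n0; rewrite lnXn// div1r lnV ?posrE// -[ln p *+ n]mulr_natr -mulNr mulfK//.
  by rewrite pnatr_eq0 -lt0n.
suff /cvg_limn_einf_sup[] : (fun n => (- ln (p ^+ n) * n%:R^-1)%:E) @ \oo -->
    (ln (1 / p))%:E by [].
by apply: cvg_near_cst; exists 1%N => // n /= n1; rewrite E.
Qed.

Lemma mkseqD (T : Type) (f : nat -> T) m n :
  mkseq f (m + n) = mkseq f m ++ mkseq (fun k => f (m + k)%N) n.
Proof.
rewrite /mkseq iotaD map_cat add0n; congr (_ ++ _).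
by rewrite -[X in iota X _]addn0 iotaDl -map_comp.
Qed.

Lemma hole_mkseq r (w : r.-tuple letter) (omega : nat -> letter) :
  hole w omega <-> mkseq omega r = w.
Proof.
split=> [hw|hw i]; last by rewrite (tnth_nth true) -hw nth_mkseq.
apply: (@eq_from_nth _ true); rewrite size_mkseq ?size_tuple// => i ir.
by rewrite nth_mkseq// (hw (Ordinal ir)) (tnth_nth true).
Qed.

Lemma iter_left_shift i omega j : iter i left_shift omega j = omega (i + j)%N.
Proof. by elim: i j => // i IH j; rewrite iterS /left_shift IH addnS. Qed.

(** * Escape rates *)

(** An occurrence of [w] at a position [i <= n] ends within the first [n + r] letters, and
    conversely. *)
Lemma survivorsE r (w : r.-tuple letter) n :
  survivors w n = [set omega | ~~ infix w (mkseq omega (n + r))].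
Proof.
apply/seteqP; split=> omega /=.
  move=> surv; apply/negP => /infixP[s [t st]].
  have sz : (size s + (r + size t) = n + r)%N.
    by rewrite -(size_mkseq omega (n + r)) st !size_cat size_tuple.
  apply: (surv (size s)); first by lia.
  apply/hole_mkseq; apply: (@eq_from_nth _ true); rewrite size_mkseq ?size_tuple//.
  move=> i ir; rewrite nth_mkseq// iter_left_shift.
  rewrite -(nth_mkseq true omega (_ : (size s + i < n + r)%N)); last by lia.
  by rewrite st nth_cat ltnNge leq_addr /= addKn nth_cat size_tuple ir.
move=> /negP avoid i ile /hole_mkseq hw; apply: avoid; apply/infixP.
exists (mkseq omega i), (mkseq (fun k => omega (i + (r + k))%N) (n - i)).
rewrite -hw (_ : (n + r = i + (r + (n - i)))%N); last by lia.
rewrite !mkseqD; congr (_ ++ (_ ++ _)).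
by apply: eq_mkseq => k; rewrite iter_left_shift.
Qed.

Section ProductMeasure.
Context (R : realType) (p q : R) (mu : probability sequences R).
Hypothesis mu_prod : is_product_measure p q mu.

Lemma measurable_hole r (w : r.-tuple letter) :
  measurable (hole w : set sequences).
Proof. by apply: sub_sigma_algebra; exists r, w. Qed.

(** The prefix [u] is generalised so that the induction can append one letter and split the event in
    two disjoint parts; for [n = 0] the event is empty or a cylinder, where [mu] is known. *)
Lemma product_measure_mkseq_prefix n (u : seq letter) (P : pred (seq letter)) :
  let E := [set omega : sequences |
    mkseq omega (size u) = u /\ P (mkseq omega (size u + n))] in
  measurable E /\
  mu E = (seq_prob p q u * bernoulli_mass p q n (fun s => P (u ++ s)))%:E.
Proof.
elim: n u => [|n IH] u /=.
  rewrite cats0 addn0; case Pu : (P u); last first.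
    rewrite (_ : [set _ | _] = set0) ?measure0 ?mulr0//.
    by apply/seteqP; split=> // omega [/= ->]; rewrite Pu.
  rewrite (_ : [set _ | _] = hole (in_tuple u)).
    split; first exact: measurable_hole.
    by rewrite mu_prod tuple_seq_prob mulr1.
  apply/seteqP; split=> omega /=; first by move=> [uo _]; apply/hole_mkseq.
  by move=> /hole_mkseq uo; rewrite /= in uo; rewrite uo.
have [mT muT] := IH (rcons u true); have [mF muF] := IH (rcons u false).
set ET := [set _ | _] in mT muT; set EF := [set _ | _] in mF muF.
rewrite (_ : [set _ | _] = ET `|` EF); last first.
  rewrite /ET /EF !size_rcons !addSnnS; apply/seteqP; split=> omega /=.
    move=> [uo Po]; rewrite mkseqS uo.
    by case: (omega (size u)); [left|right].
  have size1 x : mkseq omega (size u).+1 = rcons u x -> mkseq omega (size u) = u.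
    by rewrite mkseqS => /rcons_inj[].
  by move=> [[/size1 uo Po]|[/size1 uo Po]].
split; first exact: measurableU.
rewrite measureU//; last first.
  apply/seteqP; split=> // omega [[/= eT _] [/= + _]].
  by rewrite !size_rcons in eT *; rewrite eT => /rcons_inj[].
transitivity ((seq_prob p q (rcons u true) *
    bernoulli_mass p q n (fun s => P (rcons u true ++ s)))%:E +
  (seq_prob p q (rcons u false) *
    bernoulli_mass p q n (fun s => P (rcons u false ++ s)))%:E)%E.
  exact: (f_equal2 adde muT muF).
have rconsE x : bernoulli_mass p q n (fun s => P (rcons u x ++ s)) =
    bernoulli_mass p q n (fun s => P (u ++ x :: s)).
  by apply: mass_ext => s _; rewrite cat_rcons.
by rewrite !rconsE !seq_prob_rcons -EFinD /=; congr (_%:E); ring.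
Qed.

Lemma survivors_prob r (w : r.-tuple letter) n :
  mu (survivors w n) = (avoidance p q w (n + r))%:E.
Proof.
have [_ E] := product_measure_mkseq_prefix (n + r) [::] (fun s => ~~ infix w s).
rewrite /seq_prob big_nil mul1r in E; rewrite -[RHS]E survivorsE; congr (mu _).
by apply/seteqP; split=> omega /=; [split|case].
Qed.

Lemma escape_rateE r (w : r.-tuple letter) :
  (forall n, 0 < avoidance p q w n) ->
  escape_rate mu w = decay_rate (fun n => avoidance p q w (n + r)).
Proof.
move=> A_gt0; rewrite /escape_rate /decay_rate; congr (limn_einf _).
by apply/funext => n; rewrite survivors_prob lne_EFin// EFinM EFinN.
Qed.

Hypotheses (p_gt0 : 0 < p) (q_gt0 : 0 < q) (pq1 : p + q = 1) (q_le_p : q <= p).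

Lemma avoidance_ge_power (w : seq letter) n :
  false \in w -> p ^+ n <= avoidance p q w n.
Proof. by move=> wF; exact: (@avoid_ge_constant _ _ _ p_gt0 q_gt0 true). Qed.

(** A nonempty word contains one of the two letters, and the constant word in the other letter
    avoids it. *)
Lemma avoidance_gt0 (w : seq letter) n : w != [::] -> 0 < avoidance p q w n.
Proof.
move=> w_neq0; have [wF|/notin_false_nseq wE] := boolP (false \in w).
  by apply: lt_le_trans (avoidance_ge_power _ wF); rewrite exprn_gt0.
apply: (lt_le_trans _ (@avoid_ge_constant _ _ _ p_gt0 q_gt0 false _ _ _)).
  by rewrite exprn_gt0.
by case: w w_neq0 wE => //= x w _ [->]; rewrite mem_head.
Qed.

(** * Comparison of the holes of a fixed length *)

Section FixedLength.
Context (r : nat).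
Hypothesis r_ge2 : (2 <= r)%N.
Implicit Types w wP : r.-tuple letter.

Let prednr : r = r.-1.+1. Proof. by rewrite prednK// ltnW. Qed.

Lemma avoidance_tuple_gt0 w n : 0 < avoidance p q w n.
Proof.
apply: avoidance_gt0; apply/eqP => w0.
by have := r_ge2; rewrite -(size_tuple w) w0.
Qed.

Lemma escape_rate_le w w' (C : R) :
  (forall n, avoidance p q w' n <= C * n.+1%:R * avoidance p q w n) ->
  (escape_rate mu w <= escape_rate mu w')%E.
Proof.
move=> ww'; rewrite !escape_rateE; [|exact: avoidance_tuple_gt0..].
(* The index shift by [r] is absorbed through [n + r + 1 <= (r + 1) (n + 1)]. *)
apply: (@decay_rate_le _ (C * r.+1%:R)) => n; try exact: avoidance_tuple_gt0.
have C0 : 0 <= C.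
  have := lt_le_trans (avoidance_tuple_gt0 w' 0%N) (ww' 0%N).
  by rewrite mulr1 pmulr_lgt0 ?avoidance_tuple_gt0// => /ltW.
apply: (le_trans (ww' _)); rewrite ler_pM2r ?avoidance_tuple_gt0//.
by rewrite -mulrA ler_wpM2l// -natrM ler_nat; lia.
Qed.

Lemma escape_rate_le_ln w (c : R) : 0 < c ->
  (forall n, c * p ^+ n <= avoidance p q w n) ->
  (escape_rate mu w <= (ln (1 / p))%:E)%E.
Proof.
move=> c0 cw; rewrite escape_rateE; last exact: avoidance_tuple_gt0.
rewrite -decay_rate_expr//.
apply: (@decay_rate_le _ (c * p ^+ r)^-1) => n; rewrite ?exprn_gt0//.
  exact: avoidance_tuple_gt0.
rewrite -mulrA ler_pdivlMl ?mulr_gt0 ?exprn_gt0//.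
rewrite -mulrA -exprD addnC; apply: (le_trans (cw _)).
by rewrite ler_peMl ?ler1n// ltW// avoidance_tuple_gt0.
Qed.

Lemma ln_le_escape_rate w (C : R) :
  (forall n, avoidance p q w n <= C * n.+1%:R * p ^+ n) ->
  ((ln (1 / p))%:E <= escape_rate mu w)%E.
Proof.
move=> wC; rewrite escape_rateE; last exact: avoidance_tuple_gt0.
have C0 : 0 <= C.
  have := lt_le_trans (avoidance_tuple_gt0 w 0%N) (wC 0%N).
  by rewrite !mulr1 => /ltW.
rewrite -decay_rate_expr//.
apply: (@decay_rate_le _ (C * r.+1%:R)) => n; rewrite ?exprn_gt0//.
  exact: avoidance_tuple_gt0.
apply: (le_trans (wC _)); apply: ler_pM; rewrite ?mulr_ge0 ?exprn_ge0//.
- exact: ltW.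
- by rewrite -mulrA ler_wpM2l// -natrM ler_nat; lia.
by rewrite ler_wiXn2l ?leq_addr ?(ltW p_gt0)// -pq1 lerDl ltW.
Qed.

Lemma max_prime_recursion wP n : max_prime_words p q r wP -> (r.-1 <= n)%N ->
  avoidance p q wP n.+1 =
  avoidance p q wP n - p ^+ r.-1 * q * avoidance p q wP (n - r.-1).
Proof.
move=> /max_prime_wordsP -/(_ p_gt0 q_gt0 q_le_p r_ge2)[w_prime <-] rn.
have := avoid_recursion_prime (n := n) p_gt0 q_gt0 pq1 (w := wP).
rewrite size_tuple (_ : n.+1 - r = n - r.-1)%N; last by lia.
by apply; [lia|lia|exact/prime_holeP].
Qed.

(** Both avoidance sequences are 1 below [r]. With the common coefficient [p ^ (r - 1) q], the
    recursion is an equality for [wP] and an inequality for [w], so [delay_recursion_comparison]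
    applies. *)
Lemma escape_rate_le_max_prime w wP :
  max_prime_words p q r wP -> false \in (w : seq letter) ->
  (escape_rate mu w <= escape_rate mu wP)%E.
Proof.
move=> wP_max wF; apply: (@escape_rate_le _ _ 1) => n.
apply: (@le_trans _ _ (avoidance p q w n)); last first.
  by rewrite mul1r ler_peMl ?ler1n// ltW// avoidance_tuple_gt0.
have c_ge0 : 0 <= p ^+ r.-1 * q by rewrite mulr_ge0 ?exprn_ge0// ltW.
apply: (delay_recursion_comparison (r := r) _ c_ge0) => //.
- by lia.
- exact: avoidance_tuple_gt0.
- exact: avoidance_tuple_gt0.
- by move=> k kr; rewrite !avoid_short// size_tuple.
- move=> k rk; have := avoid_recursion_ge (n := k) p_gt0 q_gt0 pq1 (w := w).
  rewrite size_tuple => /(_ (ltnW r_ge2) rk); apply: le_trans.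
  rewrite lerD2l lerN2 ler_pM2r ?avoidance_tuple_gt0//.
  by have := seq_prob_le_one_false p_gt0 q_gt0 q_le_p wF; rewrite size_tuple.
move=> k rk; rewrite max_prime_recursion//; last by lia.
by congr (_ - _ * _); congr avoidance; lia.
Qed.

Let avoid_runs_rec : run_recursion p q r r (avoidance p q (nseq r true)).
Proof. by move=> n rn; exact: avoid_runs_recursion. Qed.

Let avoid_runs_short n : (n < r)%N -> avoidance p q (nseq r true) n = 1.
Proof. by move=> nr; rewrite avoid_short// size_nseq. Qed.

Lemma escape_rate_runs_le_max_prime w wP :
  max_prime_words p q r wP -> w = nseq r true :> seq letter -> p <= r%:R * q ->
  (escape_rate mu w <= escape_rate mu wP)%E.
Proof.
move=> wP_max wE rq; apply: (@escape_rate_le _ _ (q ^+ r)^-1) => n.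
rewrite -mulrA ler_pdivlMl ?exprn_gt0// wE.
have := @prime_recursion_le_run _ p q p_gt0 q_gt0 pq1 r.-1
  (avoidance p q wP) _ _ (avoidance p q (nseq r true)).
rewrite -prednr; apply=> //.
- by move=> k kr; rewrite avoid_short// size_tuple prednr.
- by move=> k; exact: max_prime_recursion.
- by move=> k; exact: avoid_ge0.
Qed.

Lemma ln_le_escape_rate_runs w :
  w = nseq r true :> seq letter -> r%:R * q <= p ->
  ((ln (1 / p))%:E <= escape_rate mu w)%E.
Proof.
move=> wE rq; apply: (@ln_le_escape_rate _ (p ^+ r)^-1) => n.
rewrite -mulrA ler_pdivlMl ?exprn_gt0// wE.
apply: (@le_trans _ _ (p ^+ n)).
  apply: (run_recursion_upper p_gt0 q_gt0 pq1 (leqnn r)) => // k kr.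
  by rewrite avoid_runs_short.
by rewrite ler_peMl ?ler1n// exprn_ge0// ltW.
Qed.

(** The word [a ^ n] avoids [wP], giving the upper bound on the rate; [prime_recursion_le_power]
    with [s = r - 1] gives the lower one. *)
Lemma max_prime_escape_rate wP :
  max_prime_words p q r wP -> r.-1%:R * q <= p ->
  escape_rate mu wP = (ln (1 / p))%:E.
Proof.
move=> wP_max rq; apply/eqP; rewrite eq_le; apply/andP; split.
  apply: (@escape_rate_le_ln _ 1) => // n; rewrite mul1r.
  by apply: avoidance_ge_power; case: wP_max => /(prime_hole_has_false r_ge2).
apply: (@ln_le_escape_rate _ (p ^+ r)^-1) => n.
rewrite -mulrA ler_pdivlMl ?exprn_gt0//.
have := @prime_recursion_le_power _ p q p_gt0 q_gt0 pq1 r.-1 (avoidance p q wP).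
rewrite -prednr; apply=> //.
- by move=> k kr; rewrite avoid_short// size_tuple prednr.
by move=> k; exact: max_prime_recursion.
Qed.

Lemma max_escape_rateE w :
  (forall u : r.-tuple letter, (escape_rate mu u <= escape_rate mu w)%E) ->
  max_escape_rate mu r = escape_rate mu w.
Proof.
move=> w_max; apply/eqP; rewrite eq_le; apply/andP; split; last first.
  exact: (le_bigmax _ (fun u : r.-tuple letter => escape_rate mu u)).
by apply: bigmax_le => [|u _]; [exact: leNye|exact: w_max].
Qed.

Lemma max_escape_rate_prime wP :
  max_prime_words p q r wP -> p <= r%:R * q ->
  max_escape_rate mu r = escape_rate mu wP.
Proof.
move=> wP_max rq; apply: max_escape_rateE => u.
have [uF|/notin_false_nseq uE] := boolP (false \in (u : seq letter)).
  exact: escape_rate_le_max_prime.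
by rewrite size_tuple in uE; exact: escape_rate_runs_le_max_prime.
Qed.

(** The value [ln (1 / p)] separates the rates: words containing [b] lie at or below it, and [a ^ r]
    at or above. *)
Lemma max_escape_rate_runs w :
  w = nseq r true :> seq letter -> r%:R * q <= p ->
  max_escape_rate mu r = escape_rate mu w.
Proof.
move=> wE rq; apply: max_escape_rateE => u.
have [uF|/notin_false_nseq uE] := boolP (false \in (u : seq letter)).
  apply: le_trans (ln_le_escape_rate_runs wE rq).
  by apply: (@escape_rate_le_ln _ 1) => // n; rewrite mul1r avoidance_ge_power.
by rewrite size_tuple -wE in uE; rewrite (val_inj uE).
Qed.

End FixedLength.
End ProductMeasure.

Theorem theorem3p5 (R : realType) (p q : R) (mu : probability sequences R) (r : nat)
    (q_gt0 : 0 < q) (q_le_p : q <= p) (pq1 : p + q = 1)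
    (mu_prod : is_product_measure p q mu) (r_ge2 : (2 <= r)%N) :
  [/\ p \in `[1 / 2%:R, 1 - 1 / (r.+1)%:R] ->
        forall wP : r.-tuple letter, max_prime_words p q r wP ->
          max_escape_rate mu r = escape_rate mu wP,
      p \in `[1 - 1 / (r.+1)%:R, 1[ ->
        forall wM : r.-tuple letter, max_words p q r wM ->
          max_escape_rate mu r = escape_rate mu wM
    & p \in `[1 - 1 / r%:R, 1 - 1 / (r.+1)%:R] ->
        (forall wP : r.-tuple letter, max_prime_words p q r wP ->
          escape_rate mu wP = (ln (1 / p))%:E) /\
        max_escape_rate mu r = (ln (1 / p))%:E].
Proof.
have p_gt0 : 0 < p := lt_le_trans q_gt0 q_le_p.
have qE : q = 1 - p by rewrite -pq1 addrC addKr.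
(* Both thresholds say how [1] compares with [k q = (k - 1) q + q]. They are used for [k = r + 1]
   and [k = r], giving the conditions on [r q] and [(r - 1) q]. *)
have le_thr k : (0 < k)%N -> (p <= 1 - 1 / k%:R) = (p <= k.-1%:R * q).
  move=> k_gt0; rewrite lerBrDr -lerBrDl -qE div1r -[_^-1]mul1r.
  rewrite ler_pdivrMr ?ltr0n// -{1}(prednK k_gt0) -natr1 mulrDr mulr1 -lerBlDr.
  by rewrite mulrC (_ : 1 - q = p)// -pq1 addrK.
have ge_thr k : (0 < k)%N -> (1 - 1 / k%:R <= p) = (k.-1%:R * q <= p).
  move=> k_gt0; rewrite lerBlDr -lerBlDl -qE div1r -[_^-1]mul1r.
  rewrite ler_pdivlMr ?ltr0n// -{1}(prednK k_gt0) -natr1 mulrDr mulr1 -lerBrDr.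
  by rewrite mulrC (_ : 1 - q = p)// -pq1 addrK.
split.
- rewrite in_itv /= le_thr// => /andP[_ rq] wP wP_max.
  exact: (max_escape_rate_prime mu_prod).
- rewrite in_itv /= ge_thr// => /andP[rq _] wM wM_max.
  apply: (max_escape_rate_runs mu_prod p_gt0 q_gt0) => //.
  (* Strictness [q < p], which makes [a ^ r] the only word of maximal measure, comes from [r q <= p]
     and [r >= 2]. *)
  apply: max_words_nseq_true wM_max => //; apply: lt_le_trans rq.
  by rewrite ltr_pMl// ltr1n.
rewrite in_itv /= le_thr// ge_thr ?(ltnW r_ge2)// => /andP[rq1 rq].
have wP_rate wP : max_prime_words p q r wP -> escape_rate mu wP = (ln (1 / p))%:E.
  by move=> wP_max; exact: (max_prime_escape_rate mu_prod).
(* The value of the maximum requires an actual maximal prime word. *)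
split=> //; have [w w_prime w_prob] := exists_prime_hole_prob p q (ltnW r_ge2).
have w_max : max_prime_words p q r w by exact/max_prime_wordsP.
by rewrite -(wP_rate w)//; exact: (max_escape_rate_prime mu_prod).
Qed.
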